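(* Let $N,L\ge 1$ and $M\ge 1$ be integers. Let $P^0,\dots,P^N$ be real matrices with rows indexed by $\{0,\dots,L\}$ and columns indexed by $\{1,\dots,M\}$, and let $h^1,\dots,h^N$ be real filters $h^i=(h^i_s)_{-L\le s\le L}$. For $\chi\in\mathbb{R}^M$ let $y=(y_t)_{0\le t\le L}$ be the output of the order-$N$ Hyena operator with projections $x^i=P^i\chi$ and filters $h^1,\dots,h^N$. Then for each $t\in\{0,\dots,L\}$, $y_t$ is a homogeneous polynomial of degree $N+1$ in the entries of $\chi$: there are coefficients $\eta^{(t)}_{(m_0,\dots,m_N)}$, each a polynomial function of the parameters (the entries of the $h^i$ and of the $P^j$) and independent of $\chi$, such that $$y_t=\sum_{m_0=1}^M\cdots\sum_{m_N=1}^M \eta^{(t)}_{(m_0,\dots,m_N)}\,\prod_{j=0}^N \chi_{m_j}.$$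
   Context: Order-$N$ Hyena operator: given vectors $x^0,x^1,\dots,x^N$ indexed by $t\in\{0,\dots,L\}$ (linear projections of the input $\chi$) and filters $h^1,\dots,h^N$, define $z^1_t=x^0_t$, $z^{n+1}_t=x^n_t\,(h^n\ast z^n)_t$ for $n=1,\dots,N$, and $y_t=z^{N+1}_t$, where $(h\ast z)_t=\sum_{s=0}^L h_{t-s}z_s$. The zero polynomial is counted as homogeneous of every degree. *)

(* Defs.v *)
From HB Require Import structures.
From mathcomp Require Import all_boot all_order all_algebra.
From mathcomp Require Import reals.
From mathcomp Require Export mpoly.

Set Implicit Arguments.
Unset Strict Implicit.
Unset Printing Implicit Defensive.

Import GRing.Theory.
Local Open Scope ring_scope.

(* A filter (h_s) with -L <= s <= L is stored as a row of length 2L+1 whose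
   entry k is h_(k - L). [lag t s] is the position of h_(t - s); the natural
   subtraction is exact and the result is <= 2L because s, t <= L. *)
Definition lag (L : nat) (t s : 'I_L.+1) : 'I_(L + L).+1 := inord (t + L - s).

Definition conv (R : pzRingType) (L : nat)
    (h : 'rV[R]_(L + L).+1) (z : 'cV[R]_L.+1) : 'cV[R]_L.+1 :=
  \col_t \sum_(s < L.+1) h 0 (lag t s) * z s 0.

(* [hyena x h] is z^(N+1) for projections x i = x^i (0 <= i <= N) and filters
   h i = h^(i+1) (0 <= i < N). Since z^n only involves x^0, ..., x^(n-1) and
   h^1, ..., h^(n-1), it is the output of the order-(n-1) operator on these
   initial segments, and the recursion below is
   z^1_t = x^0_t,  z^(n+1)_t = x^n_t (h^n * z^n)_t. *)
Fixpoint hyena (R : pzRingType) (L N : nat) :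
    ('I_N.+1 -> 'cV[R]_L.+1) -> ('I_N -> 'rV[R]_(L + L).+1) -> 'cV[R]_L.+1 :=
  match N return ('I_N.+1 -> 'cV[R]_L.+1) ->
                 ('I_N -> 'rV[R]_(L + L).+1) -> 'cV[R]_L.+1 with
  | 0 => fun x _ => x ord0
  | n.+1 => fun x h =>
      let z := hyena (fun i : 'I_n.+1 => x (widen_ord (leqnSn n.+1) i))
                     (fun i : 'I_n => h (widen_ord (leqnSn n) i)) in
      \col_t (x ord_max t 0 * conv (h ord_max) z t 0)
  end.

(* Names of the scalar parameters: the entries of the N filters, then those of
   the N+1 projection matrices. *)
Definition param (N L M : nat) : finType :=
  ('I_N * 'I_(L + L).+1 + 'I_N.+1 * 'I_L.+1 * 'I_M)%type.

Definition param_val (R : pzRingType) (N L M : nat)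
    (h : 'I_N -> 'rV[R]_(L + L).+1) (P : 'I_N.+1 -> 'M[R]_(L.+1, M))
    (p : param N L M) : R :=
  match p with
  | inl (i, k) => h i 0 k
  | inr (j, t, m) => P j t m
  end.

(* Polynomials in the parameters use the variables 'X_k, k < #|param N L M|,
   'X_k standing for the parameter [enum_val k]. *)
Definition param_env (R : pzRingType) (N L M : nat)
    (h : 'I_N -> 'rV[R]_(L + L).+1) (P : 'I_N.+1 -> 'M[R]_(L.+1, M))
    (k : 'I_#|param N L M|) : R :=
  param_val h P (enum_val k).

(* Main.v *)
Require Import Defs.
From HB Require Import structures.
From mathcomp Require Import all_boot all_order all_algebra.
From mathcomp Require Import reals.
From mathcomp Require Import mpoly.

(* The output is multilinear in the N+1 projections, so expanding each P^i chi
   along the columns of P^i gives the claim with eta_m equal to the Hyena output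
   on the selected columns. Running the operator over the polynomial ring, on
   matrices and filters whose entries are variables, makes these coefficients
   polynomials in the parameters, because evaluation is a ring morphism. *)

Set Implicit Arguments.
Unset Strict Implicit.
Unset Printing Implicit Defensive.

Import GRing.Theory.
Local Open Scope ring_scope.

(** Projections and filters are passed as functions, so pointwise equalities need this lemma to be
    used as rewriting rules. *)
Lemma eq_hyena (R : pzRingType) (L N : nat)
    (x x' : 'I_N.+1 -> 'cV[R]_L.+1) (h h' : 'I_N -> 'rV[R]_(L + L).+1) :
  x =1 x' -> h =1 h' -> hyena x h = hyena x' h'.
Proof.
elim: N x x' h h' => [|N IHN] x x' h h' eq_x eq_h /=; first exact: eq_x.
by rewrite eq_x eq_h (IHN _ _ _ _ (fun i => eq_x _) (fun i => eq_h _)).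
Qed.

Lemma map_hyena (R S : pzRingType) (f : {rmorphism R -> S}) (L N : nat)
    (x : 'I_N.+1 -> 'cV[R]_L.+1) (h : 'I_N -> 'rV[R]_(L + L).+1) :
  map_mx f (hyena x h) =
  hyena (fun i => map_mx f (x i)) (fun i => map_mx f (h i)).
Proof.
elim: N x h => [//|N IHN] x h /=.
rewrite -IHN; apply/colP=> t; rewrite !mxE rmorphM rmorph_sum; congr (_ * _).
by apply: eq_bigr => s _; rewrite rmorphM !mxE.
Qed.

(** A function on ['I_n.+1] amounts to its restriction [g] to the first [n] indices and its last
    value [i]. The last index is the one split off because [hyena] recurses on the last
    projection. *)
Lemma big_ffun_ord_recr (V : nmodType) (I : finType) (n : nat)
    (F : {ffun 'I_n.+1 -> I} -> V) :
  \sum_f F f = \sum_(g : {ffun 'I_n -> I}) \sum_i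
    F [ffun k => if unlift ord_max k is Some j then g j else i].
Proof.
pose ext (p : {ffun 'I_n -> I} * I) : {ffun 'I_n.+1 -> I} :=
  [ffun k => if unlift ord_max k is Some j then p.1 j else p.2].
rewrite pair_big (reindex ext) //=.
exists (fun f => ([ffun j => f (lift ord_max j)], f ord_max)) => [[g i]|f] _.
  congr (_, _); last by rewrite ffunE unlift_none.
  by apply/ffunP=> j; rewrite !ffunE liftK.
by apply/ffunP=> k; rewrite ffunE /=; case: unliftP => [j|] ->; rewrite ?ffunE.
Qed.

(** Multilinear expansion, by induction on [N]: the last projection enters as a factor, and the
    earlier ones through a convolution, which is linear. *)
Lemma hyena_mulmx (R : comPzRingType) (L N M : nat)
    (P : 'I_N.+1 -> 'M[R]_(L.+1, M)) (h : 'I_N -> 'rV[R]_(L + L).+1)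
    (chi : 'cV[R]_M) (t : 'I_L.+1) :
  hyena (fun i => P i *m chi) h t 0 =
  \sum_(m : {ffun 'I_N.+1 -> 'I_M})
     hyena (fun i => col (m i) (P i)) h t 0 * \prod_(j < N.+1) chi (m j) 0.
Proof.
elim: N P h t => [|N IHN] P h t.
  rewrite big_ffun_ord_recr exchange_big /= mxE; apply: eq_bigr => i _.
  (* The inner sum runs over the functions [g] on the empty type ['I_0], of which there is exactly
     one. *)
  rewrite (eq_bigr (fun=> P ord0 t i * chi i 0)) => [|g _].
    by rewrite sumr_const card_ffun !card_ord.
  by rewrite big_ord_recl big_ord0 mulr1 !mxE ffunE (ord1 ord_max) unlift_none.
rewrite big_ffun_ord_recr /= !mxE.
under [X in _ * X]eq_bigr => s _ do rewrite IHN mulr_sumr.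
rewrite exchange_big mulr_sumr; apply: eq_bigr => g _ /=.
(* The matrix product defining the last projection supplies the last index [i]. *)
rewrite mulr_suml; apply: eq_bigr => i _.
set f := finfun _.
have fw j : f (widen_ord (leqnSn N.+1) j) = g j.
  have -> : widen_ord (leqnSn N.+1) j = lift ord_max j.
    exact/val_inj/esym/lift_max.
  by rewrite ffunE liftK.
rewrite [X in _ = _ * X]big_ord_recr /= !mxE.
rewrite (eq_bigr _ (fun j _ => congr1 (fun k => chi k 0) (fw j))).
have -> : f ord_max = i by rewrite ffunE unlift_none.
under [X in _ = _ * X * _]eq_bigr => s _ do
  rewrite (eq_hyena (fun j => congr1 (fun k => col k _) (fw j)) (frefl _)).
under eq_bigr => s _ do rewrite mulrA.
by rewrite -mulr_suml mulrACA [chi i 0 * _]mulrC.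
Qed.

Lemma dhomog_big_prod (R : comNzRingType) (n : nat) (I : finType)
    (d : I -> nat) (F : I -> {mpoly R[n]}) :
  (forall i, F i \is (d i).-homog) -> \prod_i F i \is (\sum_i d i).-homog.
Proof.
move=> homF; elim/big_ind2: _ => [|p a q b|i _]; last exact: homF.
  exact: dhomog1.
exact: dhomogM.
Qed.

Theorem mainTheorem4 (R : realType) (N L M : nat)
    (hN : (1 <= N)%N) (hL : (1 <= L)%N) (hM : (1 <= M)%N) :
  exists eta : 'I_L.+1 -> {ffun 'I_N.+1 -> 'I_M} -> {mpoly R[#|param N L M|]},
    forall (P : 'I_N.+1 -> 'M[R]_(L.+1, M)) (h : 'I_N -> 'rV[R]_(L + L).+1)
           (t : 'I_L.+1),
      (exists q : {mpoly R[M]}, q \is N.+1.-homog /\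
         forall chi : 'cV[R]_M,
           hyena (fun i => P i *m chi) h t 0 = q.@[fun m => chi m 0])
      /\
      (forall chi : 'cV[R]_M,
         hyena (fun i => P i *m chi) h t 0 =
         \sum_(m : {ffun 'I_N.+1 -> 'I_M})
            (eta t m).@[param_env h P] * \prod_(j < N.+1) chi (m j) 0).
Proof.
(* [enum_rank] inverts the [enum_val] of [param_env], so [X p] evaluates to the parameter [p]. *)
pose X (p : param N L M) : {mpoly R[#|param N L M|]} := 'X_(enum_rank p).
pose genP (i : 'I_N.+1) : 'M_(L.+1, M) := \matrix_(t, m) X (inr (i, t, m)).
pose genh (i : 'I_N) : 'rV_(L + L).+1 := \row_k X (inl (i, k)).
exists (fun t m => hyena (fun i => col (m i) (genP i)) genh t 0) => P h t.
pose c (m : {ffun 'I_N.+1 -> 'I_M}) := hyena (fun i => col (m i) (P i)) h t 0.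
split=> [|chi].
  (* The expansion of [hyena_mulmx] with each entry of [chi] replaced by a variable; every term has
     [N.+1] factors of degree 1. *)
  exists (\sum_m c m *: \prod_(j < N.+1) 'X_(m j)); split=> [|chi].
    apply: rpred_sum => m _; apply: rpredZ.
    have := @dhomog_big_prod R M 'I_N.+1 (fun=> 1%N) (fun j => 'X_(m j)).
    by rewrite sum1_card card_ord; apply=> j; rewrite dhomogX; apply/eqP/mdeg1.
  rewrite hyena_mulmx raddf_sum; apply: eq_bigr => m _ /=.
  rewrite mevalZ rmorph_prod /=; congr (_ * _).
  by apply: eq_bigr => j _; rewrite mevalXU.
rewrite hyena_mulmx; apply: eq_bigr => m _; congr (_ * _).
have evX p : (X p).@[param_env h P] = param_val h P p.
  by rewrite mevalXU /param_env enum_rankK.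
(* Evaluating one entry is read as evaluating the whole column, the form that [map_hyena]
   handles. *)
have -> : (hyena (fun i => col (m i) (genP i)) genh t 0).@[param_env h P] =
  map_mx (meval (param_env h P)) (hyena (fun i => col (m i) (genP i)) genh) t 0.
  by rewrite mxE.
rewrite map_hyena; congr (fun_of_matrix _ t 0).
by apply: eq_hyena => i; apply/matrixP=> a b; rewrite !mxE /= evX //= ord1.
Qed.
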